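(* If $\mathcal S=\{u_1,\dots,u_m\}\subset\mathcal U_d$ is a spin system, then there exists a unital completely positive linear map $\phi:\mathcal O_{{\rm spin}(m)}\to\mathcal O_{\mathcal S}$ such that $\phi(\mathfrak u_j)=u_j$ for every $j=1,\dots,m$.
   Context: $\mathcal U_d$ is the unitary group of $\mathrm M_d(\mathbb C)$. A spin system is a finite subset $\mathcal S\subset\mathcal U_d$ such that (1) $\mathcal S$ has at least two elements, (2) $u^*=u$ for every $u\in\mathcal S$, and (3) $uv=-vu$ for every pair of distinct $u,v\in\mathcal S$; in the notation $\{u_1,\dots,u_m\}$ the $u_j$ are distinct. $\mathcal O_{\mathcal S}=\mathrm{Span}\{1_d,u: u\in\mathcal S\}\subseteq \mathrm M_d(\mathbb C)$. $\mathcal A_{{\rm spin}(m)}$ is the universal unital C$^*$-algebra generated by $\mathfrak u_1,\dots,\mathfrak u_m$ subject to the relations $\mathfrak u_j^*=\mathfrak u_j$, $\mathfrak u_j^2=1$ for all $j$, and $\mathfrak u_i\mathfrak u_j+\mathfrak u_j\mathfrak u_i=0$ for all $i\ne j$; and $\mathcal O_{{\rm spin}(m)}=\mathrm{Span}\{1,\mathfrak u_1,\dots,\mathfrak u_m\}\subseteq\mathcal A_{{\rm spin}(m)}$. An operator system is a unital $*$-closed linear subspace $\mathcal R$ of a unital C$^*$-algebra $\mathcal A$; $\mathrm M_n(\mathcal R)_+$ denotes the elements of $\mathrm M_n(\mathcal R)$ positive in $\mathrm M_n(\mathcal A)$. A linear map of operator systems is completely positive if, for every $n\in\mathbb N$,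 its entrywise application to $n\times n$ matrices sends $\mathrm M_n(\mathcal R)_+$ into $\mathrm M_n(\mathcal T)_+$. *)

(* Defs.v *)
From HB Require Import structures.
From mathcomp Require Import all_boot all_order all_algebra.
From mathcomp Require Import all_classical all_reals.
From mathcomp Require Import topology normedtype.

Set Implicit Arguments.
Unset Strict Implicit.
Unset Printing Implicit Defensive.

Import Order.TTheory GRing.Theory Num.Theory.

Local Open Scope classical_set_scope.
Local Open Scope ring_scope.

(* In the structures below the scalar field C is meant to be R[i], R : realType;
   it is kept abstract because only the numClosedFieldType interface is used. *)

HB.mixin Record isStarAlgebra (C : numClosedFieldType) A
    of GRing.Algebra C A := {
  star : A -> A;
  starK : involutive star;
  starD : {morph star : x y / x + y};
  starZ : forall (c : C) (x : A), star (c *: x) = (Num.conj c) *: star x;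
  starM : forall x y : A, star (x * y) = star y * star x
}.

#[short(type="starAlgType")]
HB.structure Definition StarAlgebra (C : numClosedFieldType) :=
  {A of GRing.Algebra C A & isStarAlgebra C A}.

(* Unital complex C*-algebras. They are not an HB join of starAlgType and
   completeNormedModType, because that join would have to be declared before
   numDomainType; instead the algebra structure is added by hand on top of a
   complex Banach space. The norm takes its values in the nonnegative reals
   of C. *)
Record cstarAlg (C : numClosedFieldType) := CStarAlg {
  cstar_space : completeNormedModType C;
  cstar_one : cstar_space;
  cstar_mul : cstar_space -> cstar_space -> cstar_space;
  cstar_star : cstar_space -> cstar_space;
  cstar_mulA : associative cstar_mul;
  cstar_mul1l : left_id cstar_one cstar_mul;
  cstar_mul1r : right_id cstar_one cstar_mul;
  cstar_mulDl : left_distributive cstar_mul +%R;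
  cstar_mulDr : right_distributive cstar_mul +%R;
  cstar_oner_neq0 : cstar_one != 0;
  cstar_scalerAl : forall (c : C) x y,
    c *: cstar_mul x y = cstar_mul (c *: x) y;
  cstar_scalerAr : forall (c : C) x y,
    c *: cstar_mul x y = cstar_mul x (c *: y);
  cstar_starK : involutive cstar_star;
  cstar_starD : {morph cstar_star : x y / x + y};
  cstar_starZ : forall (c : C) x, cstar_star (c *: x) = Num.conj c *: cstar_star x;
  cstar_starM : forall x y,
    cstar_star (cstar_mul x y) = cstar_mul (cstar_star y) (cstar_star x);
  cstar_normM : forall x y, `|cstar_mul x y| <= `|x| * `|y|;
  cstar_normE : forall x, `|cstar_mul (cstar_star x) x| = `|x| ^+ 2
}.

Definition cstar_sort (C : numClosedFieldType) (A : cstarAlg C) : Type :=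
  cstar_space A.
Coercion cstar_sort : cstarAlg >-> Sortclass.

Section CStarAlgTheory.
Variables (C : numClosedFieldType) (A : cstarAlg C).

HB.instance Definition _ :=
  CompleteNormedModule.copy (cstar_sort A) (cstar_space A).
HB.instance Definition _ := GRing.Zmodule_isNzRing.Build (cstar_sort A)
  (@cstar_mulA C A) (@cstar_mul1l C A) (@cstar_mul1r C A)
  (@cstar_mulDl C A) (@cstar_mulDr C A) (@cstar_oner_neq0 C A).
HB.instance Definition _ := GRing.LSemiModule_isLSemiAlgebra.Build C
  (cstar_sort A) (@cstar_scalerAl C A).
HB.instance Definition _ := GRing.LSemiAlgebra_isSemiAlgebra.Build C
  (cstar_sort A) (@cstar_scalerAr C A).
HB.instance Definition _ := isStarAlgebra.Build C (cstar_sort A)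
  (@cstar_starK C A) (@cstar_starD C A) (@cstar_starZ C A) (@cstar_starM C A).

End CStarAlgTheory.

Section MatrixStar.
Variables (C : numClosedFieldType) (d : nat).

Definition conjtmx (a : 'M[C]_d.+1) : 'M[C]_d.+1 := map_mx Num.conj a^T.

Lemma conjtmxK : involutive conjtmx.
Proof. by move=> a; apply/matrixP => i j; rewrite !mxE conjCK. Qed.

Lemma conjtmxD : {morph conjtmx : a b / a + b}.
Proof. by move=> a b; apply/matrixP => i j; rewrite !mxE rmorphD. Qed.

Lemma conjtmxZ (c : C) a : conjtmx (c *: a) = Num.conj c *: conjtmx a.
Proof. by apply/matrixP => i j; rewrite !mxE rmorphM. Qed.

Lemma conjtmxM a b : conjtmx (a * b) = conjtmx b * conjtmx a.
Proof. by rewrite /conjtmx -!mulmxE trmx_mul map_mxM. Qed.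

HB.instance Definition _ := isStarAlgebra.Build C 'M[C]_d.+1
  conjtmxK conjtmxD conjtmxZ conjtmxM.

End MatrixStar.

Section MatrixPositivity.
Variables (C : numClosedFieldType) (A : starAlgType C) (n : nat).

Definition mxstar (a : 'M[A]_n) : 'M[A]_n := \matrix_(i, j) star (a j i).

Definition mxspectrum (a : 'M[A]_n) : set C :=
  [set z | ~ exists b : 'M[A]_n,
     (a - z%:A%:M) *m b = 1%:M /\ b *m (a - z%:A%:M) = 1%:M].

(* Positivity in the C*-algebra M_n(A). The C*-norm of M_n(A) plays no role:
   positive means self-adjoint with spectrum in [0, +oo), and [0 <= z] in C
   entails that z is real. *)
Definition mxpositive (a : 'M[A]_n) : Prop :=
  mxstar a = a /\ mxspectrum a `<=` [set z | 0 <= z].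

End MatrixPositivity.

(* Operator systems. The ambient C*-algebra enters their theory only through
   its *-algebra structure (see mxpositive), so that is all the record asks
   for; this allows M_d(C) as ambient algebra without choosing an instance for
   its operator norm. *)
Record opsys (C : numClosedFieldType) (A : starAlgType C) := OpSys {
  opsys_set : set A;
  opsys_has1 : opsys_set 1;
  opsys_has0 : opsys_set 0;
  opsys_has_lin : forall (c : C) x y,
    opsys_set x -> opsys_set y -> opsys_set (c *: x + y);
  opsys_has_star : forall x, opsys_set x -> opsys_set (star x)
}.

Section OpSysType.
Variables (C : numClosedFieldType) (A : starAlgType C) (V : opsys A).

Definition opsys_mem : {pred A} := fun x => `[< opsys_set V x >].

Lemma opsys_memP x : reflect (opsys_set V x) (x \in opsys_mem).
Proof. exact: asboolP. Qed.

Lemma opsys_mem_closed : submod_closed opsys_mem.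
Proof.
split; first exact/opsys_memP/opsys_has0.
by move=> c x y /opsys_memP Vx /opsys_memP Vy; exact/opsys_memP/opsys_has_lin.
Qed.

HB.instance Definition _ := GRing.isSubmodClosed.Build C A opsys_mem
  (GRing.submod_closed_semi opsys_mem_closed).

Definition opsys_sort : Type := {x : A | x \in opsys_mem}.

HB.instance Definition _ := SubChoice.on opsys_sort.
HB.instance Definition _ := [SubChoice_isSubLmodule of opsys_sort by <:].

Definition opsys_elt x (Vx : opsys_set V x) : opsys_sort :=
  exist _ x (introT (opsys_memP x) Vx).

Definition opsys_one : opsys_sort := opsys_elt (opsys_has1 V).

End OpSysType.

Coercion opsys_sort : opsys >-> Sortclass.

Definition opsys_mxpositive (C : numClosedFieldType) (A : starAlgType C)
    (V : opsys A) (n : nat) (a : 'M[V]_n) : Prop :=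
  mxpositive (map_mx (val : V -> A) a).

Section CompletelyPositive.
Variables (C : numClosedFieldType) (A B : starAlgType C).
Variables (V : opsys A) (W : opsys B).

Definition unital (phi : V -> W) : Prop := phi (opsys_one V) = opsys_one W.

Definition completely_positive (phi : V -> W) : Prop :=
  forall n (a : 'M[V]_n),
    opsys_mxpositive a -> opsys_mxpositive (map_mx phi a).

End CompletelyPositive.

Section Span.
Variables (C : numClosedFieldType) (A : starAlgType C).

Definition lspan (X : set A) : set A :=
  [set x | exists2 s : seq (C * A), (forall p, p \in s -> X p.2)
                                  & x = \sum_(p <- s) p.1 *: p.2].

Lemma sub_lspan (X : set A) : X `<=` lspan X.
Proof.
move=> x Xx; exists [:: (1, x)]; last by rewrite big_seq1 scale1r.
by move=> p; rewrite inE => /eqP ->.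
Qed.

Lemma lspan0 (X : set A) : lspan X 0.
Proof. by exists [::]; rewrite ?big_nil. Qed.

Lemma lspan_lin (X : set A) (c : C) x y :
  lspan X x -> lspan X y -> lspan X (c *: x + y).
Proof.
move=> [s sX ->] [t tX ->].
exists ([seq (c * p.1, p.2) | p <- s] ++ t).
  move=> p; rewrite mem_cat => /orP[/mapP[q qs ->]|/tX //].
  exact: sX qs.
rewrite big_cat big_map scaler_sumr; congr (_ + _).
by apply: eq_bigr => p _; rewrite scalerA.
Qed.

Lemma lspan_star (X : set A) x :
  (forall y, X y -> X (star y)) -> lspan X x -> lspan X (star x).
Proof.
move=> Xstar [s sX ->].
have star0 : star (0 : A) = 0.
  by apply: (addrI (star 0)); rewrite -starD !addr0.
exists [seq (Num.conj p.1, star p.2) | p <- s].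
  by move=> p /mapP[q /sX Xq ->]; exact: Xstar.
rewrite big_map (big_morph star (@starD _ _) star0).
by apply: eq_bigr => p _; rewrite starZ.
Qed.

Lemma star1 : star (1 : A) = 1.
Proof. by rewrite -[LHS]mul1r -{1}(starK 1) -starM mul1r starK. Qed.

Variables (X : set A) (Xsa : forall x, X x -> star x = x).

Lemma lspan1_star x :
  lspan ([set 1] `|` X) x -> lspan ([set 1] `|` X) (star x).
Proof.
apply: lspan_star => y [->|Xy]; first by left; exact: star1.
by right; rewrite Xsa.
Qed.

(* Span{1, x : x in X}, for X a set of self-adjoint elements. *)
Definition opsys_span : opsys A := @OpSys C A (lspan ([set 1] `|` X))
  (sub_lspan (or_introl erefl)) (lspan0 _) (@lspan_lin _) lspan1_star.

Lemma opsys_span_sub x : X x -> opsys_set opsys_span x.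
Proof. by move=> Xx; apply: sub_lspan; right. Qed.

End Span.

Definition spin_relations (C : numClosedFieldType) (A : starAlgType C) (m : nat)
    (u : 'I_m -> A) : Prop :=
  [/\ forall j, star (u j) = u j,
      forall j, u j ^+ 2 = 1
    & forall i j, i != j -> u i * u j + u j * u i = 0].

(* The closed unital *-subalgebra of A generated by the set X. *)
Definition cstar_generated (C : numClosedFieldType) (A : cstarAlg C)
    (X : set A) : set A :=
  \bigcap_(B in [set B : set A |
     [/\ closed B, X `<=` B, B 1
       & [/\ forall (c : C) x y, B x -> B y -> B (c *: x + y),
             forall x y, B x -> B y -> B (x * y)
           & forall x, B x -> B (star x)]]]) B.

(* (A, u) is the universal unital C*-algebra A_spin(m) with its canonical
   generators; the morphism pi of uspin_univ is unique by uspin_gen. *)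
Record is_universal_spin (C : numClosedFieldType) (m : nat) (A : cstarAlg C)
    (u : 'I_m -> A) : Prop := IsUniversalSpin {
  uspin_rel : spin_relations u;
  uspin_gen : cstar_generated (range u) = setT;
  uspin_univ : forall (B : cstarAlg C) (v : 'I_m -> B), spin_relations v ->
    exists pi : {lrmorphism A -> B},
      (forall x, pi (star x) = star (pi x)) /\ forall j, pi (u j) = v j
}.

Section SpinOpSys.
Variables (C : numClosedFieldType) (m : nat) (A : cstarAlg C) (u : 'I_m -> A).
Hypothesis uA : is_universal_spin u.

Lemma range_uspin_sa x : range u x -> star x = x.
Proof. by move=> [j _ <-]; case: (uspin_rel uA). Qed.

Definition O_spin : opsys A := opsys_span range_uspin_sa.

Lemma range_uspin_O_spin j : opsys_set O_spin (u j).
Proof. by apply: opsys_span_sub; exists j. Qed.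

Definition spin_gen j : O_spin := opsys_elt (range_uspin_O_spin j).

End SpinOpSys.

(* The size is d.+1 because the algebra structures of matrices need a positive
   size; M_0(C) contains no spin system. *)
Record spin_system (C : numClosedFieldType) (d : nat) (S : set 'M[C]_d.+1) :
    Prop := SpinSystem {
  spin_finite : finite_set S;
  spin_unitary : forall u, S u -> u \is unitarymx;
  spin_two : exists u v, [/\ S u, S v & u != v];
  spin_sa : forall u, S u -> star u = u;
  spin_anticomm : forall u v, S u -> S v -> u != v -> u * v = - (v * u)
}.

Definition O_of (C : numClosedFieldType) (d : nat) (S : set 'M[C]_d.+1)
    (hS : spin_system S) : opsys 'M[C]_d.+1 := opsys_span (spin_sa hS).

(* Main.v *)
Require Import Defs.
From HB Require Import structures.
From mathcomp Require Import all_boot all_order all_algebra.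
From mathcomp Require Import all_classical all_reals.
From mathcomp Require Import topology normedtype.
From mathcomp Require Import sesquilinear spectral.
From mathcomp Require Import complex.

Set Implicit Arguments.
Unset Strict Implicit.
Unset Printing Implicit Defensive.

Import Order.TTheory GRing.Theory Num.Theory.

Local Open Scope classical_set_scope.
Local Open Scope ring_scope.

(** The matrices [u_j] are self-adjoint, square to [1] and anticommute pairwise,
    so they satisfy the defining relations of the universal algebra [A].
    Universality therefore yields a unital *-homomorphism [f] from [A] to the
    matrix algebra sending each generator to [u_j], and the map sought is the
    restriction of [f] to the operator systems ([opsys_restrict]): it sends
    span to span, hence one operator system into the other.

    Complete positivity is purely algebraic. The entrywise extension of [f] to
    matrices is again a unital *-homomorphism; it keeps self-adjoint elements
    self-adjoint and sends inverses to inverses, so spectra can only shrink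
    ([mxspectrum_map]) and positivity is preserved ([mxpositive_map]).

    The analytic content is that universality quantifies over C*-algebras, so
    the matrix algebra has to carry a complete C*-norm. This is the operator
    norm for the Euclidean norm of row vectors ([opnorm]): the C*-identity
    ([opnorm_cstar]) comes from Cauchy-Schwarz, and completeness
    ([opmx_complete]) from the fact that the norm lies between each modulus of
    an entry and the sum of all of them. *)

(** * The Euclidean norm of row vectors *)

Section EuclideanNorm.
Variables (C : numClosedFieldType) (n : nat).
Implicit Types v w : 'rV[C]_n.

Definition vnorm v : C := sqrtC (dotmx v v).

Lemma vnorm_ge0 v : 0 <= vnorm v.
Proof. by rewrite sqrtC_ge0 dnorm_ge0. Qed.

Lemma vnorm_sqr v : vnorm v ^+ 2 = dotmx v v.
Proof. exact: sqrtCK. Qed.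

Lemma vnorm0 : vnorm 0 = 0.
Proof. by rewrite /vnorm linear0l sqrtC0. Qed.

Lemma vnorm_eq0 v : vnorm v = 0 -> v = 0.
Proof. by move/eqP; rewrite sqrtC_eq0 dnorm_eq0 => /eqP. Qed.

Lemma ler_vnormD v w : vnorm (v + w) <= vnorm v + vnorm w.
Proof. exact: triangle_lerif. Qed.

Lemma vnormZ c v : vnorm (c *: v) = `|c| * vnorm v.
Proof.
by rewrite /vnorm dnormZ rootCMl ?exprn_ge0// -[in RHS](sqrCK (normr_ge0 c)).
Qed.

Lemma ler_vnorm_sum (I : Type) (r : seq I) (F : I -> 'rV[C]_n) :
  vnorm (\sum_(i <- r) F i) <= \sum_(i <- r) vnorm (F i).
Proof.
elim/big_rec2: _ => [|i y x _ le_xy]; first by rewrite vnorm0.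
by apply: le_trans (ler_vnormD _ _) _; rewrite lerD2l.
Qed.

Lemma ler_dotmx v w : `|dotmx v w| <= vnorm v * vnorm w.
Proof. exact: CauchySchwarz_sqrt. Qed.

Lemma vnorm_sqrE v : vnorm v ^+ 2 = \sum_j `|v 0 j| ^+ 2.
Proof.
by rewrite vnorm_sqr dotmxE mxE; apply: eq_bigr => j _; rewrite !mxE normCK.
Qed.

Lemma vnorm_delta j : vnorm (delta_mx 0 j) = 1.
Proof.
apply/eqP; rewrite -sqrp_eq1 ?vnorm_ge0// vnorm_sqrE (bigD1 j)//=.
rewrite big1 => [|k kj].
  by rewrite !mxE !eqxx normr1 addr0 expr1n.
by rewrite !mxE (negPf kj) andbF normr0 expr0n.
Qed.

Lemma ler_entry_vnorm v j : `|v 0 j| <= vnorm v.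
Proof.
rewrite -ler_sqr ?nnegrE ?vnorm_ge0// vnorm_sqrE (bigD1 j)//= lerDl.
by apply: sumr_ge0 => k _; rewrite exprn_ge0.
Qed.

Lemma ler_vnorm_entries v : vnorm v <= \sum_j `|v 0 j|.
Proof.
rewrite {1}[v]row_sum_delta; apply: le_trans (ler_vnorm_sum _ _) _.
by apply: ler_sum => j _; rewrite vnormZ vnorm_delta mulr1.
Qed.

Local Open Scope sesquilinear_scope.

Lemma dotmx_adjoint (a : 'M_n) v w : dotmx (v *m a) w = dotmx v (w *m a^t*).
Proof. by rewrite !dotmxE trmx_mul map_mxM trmxCK mulmxA. Qed.

(** The vector form of the C*-identity, from
    [|v a^*|^2 = <v, v (a^* a)> <= |v| |v (a^* a)|]. *)
Lemma vnorm_adjoint_le (a : 'M_n) v k : 0 <= k ->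
  vnorm (v *m (a^t* *m a)) <= k * vnorm v ->
  vnorm (v *m a^t*) <= sqrtC k * vnorm v.
Proof.
move=> k0 le_k; rewrite -ler_sqr ?nnegrE ?mulr_ge0 ?vnorm_ge0 ?sqrtC_ge0//.
rewrite [leLHS]vnorm_sqr exprMn sqrtCK dotmx_adjoint trmxCK -mulmxA.
have dv_ge0 : 0 <= dotmx v (v *m (a^t* *m a)).
  by rewrite mulmxA -{2}(trmxCK a) -dotmx_adjoint dnorm_ge0.
rewrite -(ger0_norm dv_ge0); apply: le_trans (ler_dotmx _ _) _.
by rewrite [leLHS]mulrC [_ ^+ 2]expr2 [leRHS]mulrA ler_wpM2r ?vnorm_ge0.
Qed.

End EuclideanNorm.

(** * The operator norm *)

Section OperatorNorm.
Variables (R : realType) (n : nat).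
Local Notation C := R[i].
Implicit Types a b : 'M[C]_n.

(** Matrices act on row vectors from the right. The supremum is taken in the
    real field and embedded back, since suprema are only available there. *)
Definition opnorm a : C :=
  (sup [set complex.Re (vnorm (v *m a)) | v in [set v | vnorm v <= 1]])%:C%C.

Lemma vnorm_mulmx_bound a v :
  vnorm (v *m a) <= (\sum_i vnorm (row i a)) * vnorm v.
Proof.
rewrite mulmx_sum_row; apply: le_trans (ler_vnorm_sum _ _) _.
rewrite mulr_suml; apply: ler_sum => i _; rewrite vnormZ mulrC.
by rewrite ler_wpM2l ?vnorm_ge0 ?ler_entry_vnorm.
Qed.

Lemma vnorm_Re m (v : 'rV[C]_m) : (complex.Re (vnorm v))%:C%C = vnorm v.
Proof. by apply: RRe_real; rewrite ger0_real ?vnorm_ge0. Qed.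

(** Finiteness of the operator norm; an unbounded set would have the junk
    supremum [0]. *)
Lemma opnorm_has_ubound a :
  has_ubound [set complex.Re (vnorm (v *m a)) | v in [set v | vnorm v <= 1]].
Proof.
exists (complex.Re (\sum_i vnorm (row i a))) => _ [w /= w1 <-].
have sum_ge0 : 0 <= \sum_i vnorm (row i a).
  by apply: sumr_ge0 => i _; exact: vnorm_ge0.
rewrite -lecR vnorm_Re RRe_real ?ger0_real//.
by apply: le_trans (vnorm_mulmx_bound _ _) _; rewrite ler_piMr.
Qed.

Lemma vnorm_mulmx a v : vnorm (v *m a) <= opnorm a * vnorm v.
Proof.
have [->|v0] := eqVneq v 0; first by rewrite mul0mx vnorm0 mulr0.
have nv0 : 0 < vnorm v.
  by rewrite lt_def vnorm_ge0 andbT; apply: contra_neq v0 => /vnorm_eq0.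
rewrite -ler_pdivrMr// mulrC.
rewrite -[X in X * _](@ger0_norm _ (vnorm v)^-1) ?invr_ge0 ?vnorm_ge0//.
rewrite -vnormZ scalemxAl -vnorm_Re lecR.
apply: (ub_le_sup (opnorm_has_ubound a)); exists ((vnorm v)^-1 *: v) => //=.
by rewrite vnormZ normfV ger0_norm ?vnorm_ge0// mulVf ?gt_eqF.
Qed.

Lemma opnorm_le a (k : C) : 0 <= k ->
  (forall v, vnorm (v *m a) <= k * vnorm v) -> opnorm a <= k.
Proof.
move=> k0 ak; rewrite -(RRe_real (ger0_real k0)) lecR; apply: ge_sup.
  by exists (complex.Re (vnorm (0 *m a))); exists 0 => //=; rewrite vnorm0.
move=> _ [v /= v1 <-]; rewrite -lecR vnorm_Re RRe_real ?ger0_real//.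
by apply: le_trans (ak v) _; rewrite ler_piMr.
Qed.

Lemma opnorm_ge0 a : 0 <= opnorm a.
Proof.
rewrite ler0c; apply: (ub_le_sup (opnorm_has_ubound a)).
by exists 0; rewrite /= ?mul0mx vnorm0.
Qed.

Lemma ler_opnormD a b : opnorm (a + b) <= opnorm a + opnorm b.
Proof.
apply: opnorm_le => [|v]; first by rewrite addr_ge0 ?opnorm_ge0.
rewrite mulmxDr mulrDl; apply: le_trans (ler_vnormD _ _) _.
by rewrite lerD ?vnorm_mulmx.
Qed.

Lemma opnormZ (c : C) a : opnorm (c *: a) = `|c| * opnorm a.
Proof.
(* The reverse inequality is the same bound for [c^-1] and [c *: a]. *)
have le_opnormZ l b : opnorm (l *: b) <= `|l| * opnorm b.
  apply: opnorm_le => [|v]; first by rewrite mulr_ge0 ?opnorm_ge0.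
  by rewrite -scalemxAr vnormZ -mulrA ler_wpM2l ?vnorm_mulmx.
apply/eqP; rewrite eq_le le_opnormZ/=; have [->|c0] := eqVneq c 0.
  by rewrite normr0 mul0r opnorm_ge0.
rewrite mulrC -ler_pdivlMr ?normr_gt0// mulrC -normfV.
by rewrite -{1}[a]scale1r -(mulVf c0) -scalerA le_opnormZ.
Qed.

Lemma ler_entry_opnorm a i j : `|a i j| <= opnorm a.
Proof.
have -> : a i j = row i a 0 j by rewrite mxE.
apply: le_trans (ler_entry_vnorm _ _) _; rewrite rowE.
by rewrite (le_trans (vnorm_mulmx _ _))// vnorm_delta mulr1.
Qed.

Lemma ler_opnorm_entries a : opnorm a <= \sum_i \sum_j `|a i j|.
Proof.
apply: opnorm_le => [|v]; first by do 2![apply: sumr_ge0 => ? _].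
apply: le_trans (vnorm_mulmx_bound _ _) _; rewrite ler_wpM2r ?vnorm_ge0//.
apply: ler_sum => i _; apply: le_trans (ler_vnorm_entries _) _.
by apply: ler_sum => j _; rewrite mxE.
Qed.

Lemma opnorm_eq0 a : opnorm a = 0 -> a = 0.
Proof.
move=> a0; apply/matrixP => i j; rewrite mxE; apply/eqP.
by rewrite -normr_le0 -a0 ler_entry_opnorm.
Qed.

Lemma ler_opnormM a b : opnorm (a *m b) <= opnorm a * opnorm b.
Proof.
apply: opnorm_le => [|v]; first by rewrite mulr_ge0 ?opnorm_ge0.
rewrite mulmxA mulrAC; apply: le_trans (vnorm_mulmx _ _) _.
rewrite [leLHS]mulrC; apply: ler_wpM2r; first exact: opnorm_ge0.
exact: vnorm_mulmx.
Qed.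

End OperatorNorm.

Section CStarIdentity.
Variables (R : realType) (n : nat).
Implicit Types a : 'M[R[i]]_n.
Local Open Scope sesquilinear_scope.

(** With matrices acting on the right, testing the norm of [a^*] on vectors
    produces [a^* a], the product that the C*-identity is about. *)
Lemma opnorm_adjoint_sqr a : opnorm (a^t*) ^+ 2 <= opnorm (a^t* *m a).
Proof.
rewrite -[leRHS]sqrtCK ler_sqr ?nnegrE ?sqrtC_ge0 ?opnorm_ge0//.
apply: opnorm_le => [|v]; first by rewrite sqrtC_ge0 opnorm_ge0.
apply: vnorm_adjoint_le; first exact: opnorm_ge0.
exact: vnorm_mulmx.
Qed.

(** From [|a^*|^2 <= |a^* a| <= |a^*| |a|], cancelling [|a^*|]. *)
Lemma opnorm_adjoint a : opnorm (a^t*) = opnorm a.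
Proof.
suff le_adj (b : 'M[R[i]]_n) : opnorm (b^t*) <= opnorm b.
  have le_a := le_adj (a^t*); rewrite trmxCK in le_a.
  by apply: le_anti; apply/andP; split; [exact: le_adj|exact: le_a].
have [b0|b0] := eqVneq (opnorm (b^t*)) 0.
  by apply: le_trans (opnorm_ge0 b); rewrite b0.
have bt0 : 0 < opnorm (b^t*) by rewrite lt_def b0; exact: opnorm_ge0.
rewrite -(ler_pM2l bt0); apply: le_trans (ler_opnormM _ _).
exact: opnorm_adjoint_sqr.
Qed.

Lemma opnorm_cstar a : opnorm (a^t* *m a) = opnorm a ^+ 2.
Proof.
apply: le_anti; apply/andP; split.
  by apply: le_trans (ler_opnormM _ _) _; rewrite opnorm_adjoint expr2.
by rewrite -{1}opnorm_adjoint; exact: opnorm_adjoint_sqr.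
Qed.

End CStarIdentity.

(** * The C*-algebra of square matrices *)

Section MatrixCStarAlgebra.
Import numFieldNormedType.Exports.
Variables (R : realType) (d : nat).
Local Notation C := R[i].

(** A separate name for the type of matrices, which already carries the topology
    of entrywise convergence with the maximum norm; that norm does not satisfy
    the C*-identity. *)
Definition opmx : Type := 'M[C]_d.+1.

HB.instance Definition _ := GRing.Lmodule.copy opmx 'M[C]_d.+1.
HB.instance Definition _ := Lmodule_isNormed.Build C opmx
  (@ler_opnormD R d.+1) (@opnormZ R d.+1) (@opnorm_eq0 R d.+1).

Lemma normc_le_ReIm (z : C) :
  `|z| <= (`|complex.Re z| + `|complex.Im z|)%:C%C.
Proof.
have norm_real (x : R) : `|x%:C%C : C| = `|x|%:C%C.
  by rewrite normc_def /= expr0n addr0 sqrtr_sqr.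
rewrite {1}[z]complexE; apply: le_trans (ler_normD _ _) _.
by rewrite normrM complexiE normCi mul1r !norm_real rmorphD.
Qed.

(** Real and imaginary parts of entries are dominated by the operator norm, so
    they form Cauchy filters of real numbers; the matrix of their limits is the
    limit because the operator norm is at most the sum of the moduli of the
    entries. *)
Lemma opmx_complete (F : set_system opmx) : ProperFilter F -> cauchy F -> cvg F.
Proof.
move=> FF /cauchyP Fc.
have coord_cvg (f : C -> R) i j : (forall x y, f (x - y) = f x - f y) ->
    (forall x, `|f x|%:C%C <= `|x|) ->
  cvg ((fun a : opmx => f (a i j)) @ F).
  move=> fB f_le; apply: R_complete; apply/cauchyP => e e0.
  have /Fc[a Fa] : 0 < e%:C%C :> C by rewrite ltcR.
  exists (f (a i j)).
  have : F [set b : opmx | `|f (a i j) - f (b i j)| < e]; last exact.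
  apply: filterS Fa => b /=; rewrite -ball_normE/= => ab.
  rewrite -fB -ltcR; apply: le_lt_trans (f_le _) _; apply: le_lt_trans ab.
  by have := ler_entry_opnorm (a - b : opmx) i j; rewrite !mxE.
have ReB (x y : C) : complex.Re (x - y) = complex.Re x - complex.Re y.
  by case: x y => [? ?] [].
have ImB (x y : C) : complex.Im (x - y) = complex.Im x - complex.Im y.
  by case: x y => [? ?] [].
have Im_le (x : C) : `|complex.Im x|%:C%C <= `|x|.
  by rewrite normc_def lecR -sqrtr_sqr ler_wsqrtr// lerDr sqr_ge0.
have reF i j := coord_cvg _ i j ReB (@normc_ge_Re R).
have imF i j := coord_cvg _ i j ImB Im_le.
pose l : opmx := \matrix_(i, j) Complex
  (lim ((fun a : opmx => complex.Re (a i j)) @ F))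
  (lim ((fun a : opmx => complex.Im (a i j)) @ F)).
have near_entry (e : C) i j : 0 < e -> F [set a : opmx | `|l i j - a i j| <= e].
  move=> e0; have eE : e = (complex.Re e)%:C%C by rewrite RRe_real// gtr0_real.
  have r0 : 0 < complex.Re e / 2 by rewrite divr_gt0// -ltcR -eE.
  have /cvgrPdist_le/(_ _ r0) reN := reF i j.
  have /cvgrPdist_le/(_ _ r0) imN := imF i j.
  have reN' : F [set a : opmx |
    `|lim ((fun a : opmx => complex.Re (a i j)) @ F) - complex.Re (a i j)|
      <= complex.Re e / 2] by exact: reN.
  have imN' : F [set a : opmx |
    `|lim ((fun a : opmx => complex.Im (a i j)) @ F) - complex.Im (a i j)|
      <= complex.Re e / 2] by exact: imN.
  apply: filterS2 reN' imN' => a /= re_a im_a.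
  apply: le_trans (normc_le_ReIm _) _.
  by rewrite eE lecR ReB ImB mxE /= (splitr (complex.Re e)) lerD.
apply/cvg_ex; exists l; apply/cvgrPdist_le => e e0.
(* [k] is the number of entries, each of which gets the share [e / k]. *)
pose k : C := \sum_(i < d.+1) \sum_(j < d.+1) 1.
have k0 : 0 < k.
  by rewrite /k !sumr_const card_ord -mulrnA ltr0n.
have : F [set a : opmx | forall i j, `|l i j - a i j| <= e / k].
  apply: filter_forall => i; apply: filter_forall => j.
  by apply: near_entry; rewrite divr_gt0.
apply: filterS => a /= la.
apply: le_trans (ler_opnorm_entries (l - a)) _.
rewrite -[leRHS](divfK (lt0r_neq0 k0)) /k mulr_sumr.
apply: ler_sum => i _; rewrite mulr_sumr; apply: ler_sum => j _.
by rewrite mulr1; have := la i j; rewrite !mxE.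
Qed.

HB.instance Definition _ := Uniform_isComplete.Build opmx opmx_complete.

Definition matrix_cstarAlg : cstarAlg C := @CStarAlg C opmx
  (1 : 'M_d.+1) (@GRing.mul 'M[C]_d.+1) (@conjtmx C d)
  (@mulrA 'M[C]_d.+1) (@mul1r 'M[C]_d.+1) (@mulr1 'M[C]_d.+1)
  (@mulrDl 'M[C]_d.+1) (@mulrDr 'M[C]_d.+1) (@oner_neq0 'M[C]_d.+1)
  (@scalerAl C 'M[C]_d.+1) (@scalerAr C 'M[C]_d.+1)
  (@conjtmxK C d) (@conjtmxD C d) (@conjtmxZ C d) (@conjtmxM C d)
  (@ler_opnormM R d.+1) (@opnorm_cstar R d.+1).

End MatrixCStarAlgebra.

(** * Restricting *-homomorphisms to operator systems *)

Section PositivityTransport.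
Variables (C : numClosedFieldType) (A B : starAlgType C) (n : nat).
Variable f : {lrmorphism A -> B}.
Hypothesis f_star : forall x, f (star x) = star (f x).

(** A unital homomorphism sends an inverse of [a - z] to one of [f a - z]. *)
Lemma mxspectrum_map (a : 'M[A]_n) :
  mxspectrum (map_mx f a) `<=` mxspectrum a.
Proof.
move=> z az [b [ab ba]]; apply: az; exists (map_mx f b).
have <- : map_mx f (a - z%:A%:M) = map_mx f a - z%:A%:M.
  by rewrite map_mxB map_scalar_mx /= rmorph_alg.
by rewrite -!map_mxM ab ba map_mx1.
Qed.

Lemma mxpositive_map (a : 'M[A]_n) : mxpositive a -> mxpositive (map_mx f a).
Proof.
move=> [a_sa a_ge0]; split; last exact: subset_trans (@mxspectrum_map a) a_ge0.
rewrite -[in RHS]a_sa; apply/matrixP => i j.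
by rewrite !mxE f_star.
Qed.

End PositivityTransport.

Section SpanMap.
Variables (C : numClosedFieldType) (A B : starAlgType C).
Variable f : {lrmorphism A -> B}.

Lemma lspan_map (X : set A) (Y : set B) : (forall x, X x -> Y (f x)) ->
  forall x, lspan X x -> lspan Y (f x).
Proof.
move=> XY _ [s sX ->]; rewrite linear_sum.
exists [seq (p.1, f p.2) | p <- s].
  by move=> _ /mapP[p /sX/XY Yp ->].
by rewrite big_map; apply: eq_bigr => p _; rewrite linearZ.
Qed.

End SpanMap.

Section RestrictMap.
Variables (C : numClosedFieldType) (A B : starAlgType C).
Variable f : {lrmorphism A -> B}.
Hypothesis f_star : forall x, f (star x) = star (f x).
Variables (V : opsys A) (W : opsys B).
Hypothesis fVW : forall x, opsys_set V x -> opsys_set W (f x).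

Definition opsys_restrict (x : V) : W :=
  opsys_elt (fVW (elimT (opsys_memP V (val x)) (valP x))).

Lemma opsys_restrict_linear : linear opsys_restrict.
Proof. by move=> c x y; apply: val_inj; rewrite /= linearP. Qed.

HB.instance Definition _ :=
  GRing.isLinear.Build C V W *:%R opsys_restrict opsys_restrict_linear.

Lemma opsys_restrict_unital : unital opsys_restrict.
Proof. by apply: val_inj; rewrite /= rmorph1. Qed.

Lemma opsys_restrict_cp : completely_positive opsys_restrict.
Proof.
move=> n a; rewrite /opsys_mxpositive.
have -> : map_mx val (map_mx opsys_restrict a) = map_mx f (map_mx val a).
  by apply/matrixP => i j; rewrite !mxE.
exact: mxpositive_map.
Qed.

End RestrictMap.

(** * The representation given by a spin system *)

Section MatrixCStarForget.
Variables (R : realType) (d : nat).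

(** The identity map, made a morphism between two algebra structures on matrices
    whose operations agree but which are distinct as instances: the one read off
    the C*-algebra record and the standard one, over which operator systems of
    matrices are built. *)
Definition mx_of_cstar (a : matrix_cstarAlg R d) : 'M[R[i]]_d.+1 := a.

Lemma mx_of_cstar_linear : linear mx_of_cstar.
Proof. by []. Qed.

Lemma mx_of_cstar_monoid : monoid_morphism mx_of_cstar.
Proof. by split. Qed.

HB.instance Definition _ := GRing.isLinear.Build R[i] (matrix_cstarAlg R d)
  'M[R[i]]_d.+1 *:%R mx_of_cstar mx_of_cstar_linear.
HB.instance Definition _ := GRing.isMonoidMorphism.Build (matrix_cstarAlg R d)
  'M[R[i]]_d.+1 mx_of_cstar mx_of_cstar_monoid.

End MatrixCStarForget.

(** A self-adjoint unitary squares to the identity. Injectivity of [u] is what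
    turns distinct indices into distinct, hence anticommuting, elements. *)
Lemma spin_system_relations (C : numClosedFieldType) (d m : nat)
    (S : set 'M[C]_d.+1) (hS : spin_system S) (u : 'I_m -> 'M[C]_d.+1) :
  injective u -> S = range u -> spin_relations u.
Proof.
move=> u_inj Su; have uS j : S (u j) by rewrite Su; exists j.
split=> [j|j|i j ij]; first exact: spin_sa hS _ (uS j).
- have : u j * star (u j) = 1 by exact/unitarymxP/(spin_unitary hS (uS j)).
  by rewrite (spin_sa hS (uS j)) -expr2.
- rewrite (spin_anticomm hS (uS i) (uS j)) ?addNr//.
  by apply: contra_neq ij => /u_inj.
Qed.

Theorem theorem1p11 (R : realType) (d m : nat)
    (A : cstarAlg R[i]) (fu : 'I_m -> A) (hA : is_universal_spin fu)
    (S : set 'M[R[i]]_d.+1) (hS : spin_system S)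
    (u : 'I_m -> 'M[R[i]]_d.+1) (u_inj : injective u) (Su : S = range u) :
  exists phi : {linear O_spin hA -> O_of hS},
    [/\ unital phi,
        completely_positive phi
      & forall j : 'I_m, val (phi (spin_gen hA j)) = u j].
Proof.
have [u_sa u_sqr u_anti] := spin_system_relations hS u_inj Su.
have u_rel : @spin_relations _ (matrix_cstarAlg R d) m u by split.
have [pi [pi_star pi_u]] := uspin_univ hA u_rel.
pose f : {lrmorphism A -> 'M[R[i]]_d.+1} := @mx_of_cstar R d \o pi.
have f_star x : f (star x) = star (f x) by exact: pi_star.
have f_span x : opsys_set (O_spin hA) x -> opsys_set (O_of hS) (f x).
  apply: lspan_map => {}x [->|[j _ <-]]; first by left; exact: rmorph1.
  by right; rewrite Su; exists j => //; rewrite /= pi_u.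
exists (opsys_restrict f_span); split.
- exact: opsys_restrict_unital.
- exact: opsys_restrict_cp.
- by move=> j; exact: pi_u.
Qed.
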